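(* Let $L$ be a distributive lattice, let $\ell\in\mathbb{N}$, and let $U_i$ and $J_i$ $(i=0,\ldots,\ell)$ be finite subsets of $L$. The following three statements are equivalent. (1) In the lattice $\mathrm{Kr}_\ell(L)$, $$\bigwedge_{i=0}^{\ell}\ \bigwedge_{u\in U_i}\varphi_i(u)\ \le\ \bigvee_{i=0}^{\ell}\ \bigvee_{j\in J_i}\varphi_i(j).$$ (2) $\varphi_0(U_0),\ldots,\varphi_\ell(U_\ell)\ \vdash_S\ \varphi_0(J_0),\ldots,\varphi_\ell(J_\ell)$. (3) There exist $x_1,\ldots,x_\ell\in L$ such that, where $\vdash$ is the entailment relation of $L$, $$\begin{array}{rcl} x_1,\ U_0&\vdash& J_0\\ x_2,\ U_1&\vdash& J_1,\ x_1\\ &\vdots&\\ x_\ell,\ U_{\ell-1}&\vdash& J_{\ell-1},\ x_{\ell-1}\\ U_\ell&\vdash& J_\ell,\ x_\ell \end{array}$$ (for $\ell=0$ this condition reads $U_0\vdash J_0$).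
   Context: Distributive lattices have a minimum $0$ and a maximum $1$; morphisms preserve $0,1,\wedge,\vee$. In a distributive lattice $L$, for finite subsets $A,B$ write $A\vdash B$ for $\bigwedge A\le\bigvee B$ (with $\bigwedge\emptyset=1$, $\bigvee\emptyset=0$). Commas denote union, and an element $x$ stands for $\{x\}$. An entailment relation on a set $S$ is a relation $\vdash$ between finite subsets of $S$ which is reflexive ($a\vdash a$ for $a\in S$), monotone (if $A\vdash B$, $A\subseteq A'$, $B\subseteq B'$ then $A'\vdash B'$) and transitive (if $A,x\vdash B$ and $A\vdash B,x$ then $A\vdash B$). $\mathrm{Kr}_\ell(L)$ is the distributive lattice presented by generators $\varphi_i(x)$ for $0\le i\le\ell$, $x\in L$ (that is, $\ell+1$ disjoint copies of $L$), and the following relations, where $A\vdash B$ stands for the relation $\bigwedge A\le\bigvee B$: $\vdash\varphi_i(1)$; $\varphi_i(0)\vdash$; $\varphi_i(a),\varphi_i(b)\vdash\varphi_i(a\wedge b)$; $\varphi_i(a\vee b)\vdash\varphi_i(a),\varphi_i(b)$; $\varphi_i(a)\vdash\varphi_i(b)$ whenever $a\le b$ in $L$; and $\varphi_{i+1}(a)\vdash\varphi_i(a)$ for $i<\ell$. $S$ is the set of generators (the disjoint union of the copies $\varphi_i(L)$) and $\vdash_S$ is the entailment relation on $S$ generated by these relations (the least entailment relation containing them). For a subset $A\subseteq L$, $\varphi_i(A)=\{\varphi_i(a): a\in A\}$. *)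

(* Defs.v *)
From HB Require Import structures.
From mathcomp Require Import all_boot all_order finmap.
From mathcomp Require Import boolp.

Set Implicit Arguments.
Unset Strict Implicit.
Unset Printing Implicit Defensive.

Import Order.Theory.
Local Open Scope fset_scope.
Local Open Scope order_scope.
Local Open Scope quotient_scope.

Definition lat_entails d (L : tbDistrLatticeType d) (A B : {fset L}) : bool :=
  \meet_(a <- A) a <= \join_(b <- B) b.

Record is_entailment (S : choiceType) (E : {fset S} -> {fset S} -> Prop) :
    Prop := IsEntailment {
  entail_refl : forall a, E [fset a] [fset a];
  entail_mono : forall A A' B B',
    A `<=` A' -> B `<=` B' -> E A B -> E A' B';
  entail_trans : forall A B x, E (x |` A) B -> E A (x |` B) -> E A B }.

Definition generated_entailment (S : choiceType)
    (R : {fset S} -> {fset S} -> Prop) (A B : {fset S}) : Prop :=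
  forall E : {fset S} -> {fset S} -> Prop, is_entailment E ->
    (forall A' B', R A' B' -> E A' B') -> E A B.

Lemma generated_entailmentP (S : choiceType)
    (R : {fset S} -> {fset S} -> Prop) :
  is_entailment (generated_entailment R) /\
  (forall A B, R A B -> generated_entailment R A B).
Proof.
split; last by move=> A B RAB E _; apply.
split=> [a E [h _ _] _|A A' B B' AA' BB' h E hE RE|A B x h1 h2 E hE RE].
- exact: h.
- exact: (entail_mono hE AA' BB' (h E hE RE)).
- exact: (entail_trans hE (h1 E hE RE) (h2 E hE RE)).
Qed.

(* The distributive lattice presented by generators S and relations R, where
   R A B stands for /\A <= \/B: formal terms modulo the equivalence associated
   with the least preorder making them a bounded distributive lattice in which
   the relations hold. *)
Section Presentation.
Variables (S : choiceType) (R : {fset S} -> {fset S} -> Prop).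

Inductive lterm : Type :=
| LGen of S
| LBot
| LTop
| LMeet of lterm & lterm
| LJoin of lterm & lterm.

HB.instance Definition _ := gen_eqMixin lterm.
HB.instance Definition _ := gen_choiceMixin lterm.

Inductive lterm_le : lterm -> lterm -> Prop :=
| lterm_le_rel A B : R A B ->
    lterm_le (\big[LMeet/LTop]_(a <- A) LGen a)
             (\big[LJoin/LBot]_(b <- B) LGen b)
| lterm_le_refl t : lterm_le t t
| lterm_le_trans t u v : lterm_le t u -> lterm_le u v -> lterm_le t v
| lterm_le0 t : lterm_le LBot t
| lterm_le1 t : lterm_le t LTop
| lterm_leIl t u : lterm_le (LMeet t u) t
| lterm_leIr t u : lterm_le (LMeet t u) u
| lterm_lexI t u v : lterm_le t u -> lterm_le t v -> lterm_le t (LMeet u v)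
| lterm_leUl t u : lterm_le t (LJoin t u)
| lterm_leUr t u : lterm_le u (LJoin t u)
| lterm_leUx t u v : lterm_le t v -> lterm_le u v -> lterm_le (LJoin t u) v
| lterm_le_distr t u v :
    lterm_le (LMeet (LJoin t u) v) (LJoin (LMeet t v) (LMeet u v)).

Definition lterm_eqv (t u : lterm) : bool := `[< lterm_le t u /\ lterm_le u t >].

Fact lterm_eqv_refl : reflexive lterm_eqv.
Proof. by move=> t; apply/asboolP; split; apply: lterm_le_refl. Qed.

Fact lterm_eqv_sym : symmetric lterm_eqv.
Proof. by move=> t u; apply/asboolP/asboolP => -[]; split. Qed.

Fact lterm_eqv_trans : transitive lterm_eqv.
Proof.
move=> u t v /asboolP[tu ut] /asboolP[uv vu]; apply/asboolP; split.
  exact: lterm_le_trans tu uv.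
exact: lterm_le_trans vu ut.
Qed.

Canonical lterm_equiv_rel :=
  EquivRel lterm_eqv lterm_eqv_refl lterm_eqv_sym lterm_eqv_trans.

Definition presented : Type := {eq_quot lterm_equiv_rel}.

HB.instance Definition _ := Quotient.on presented.
HB.instance Definition _ := Choice.on presented.

Definition pres_gen (s : S) : presented := \pi_presented (LGen s).
Definition pres_le (p q : presented) : bool := `[< lterm_le (repr p) (repr q) >].
Definition pres_meet (p q : presented) : presented :=
  \pi_presented (LMeet (repr p) (repr q)).
Definition pres_join (p q : presented) : presented :=
  \pi_presented (LJoin (repr p) (repr q)).
Definition pres_bot : presented := \pi_presented LBot.
Definition pres_top : presented := \pi_presented LTop.

Lemma lterm_reprK t :
  lterm_le (repr (\pi_presented t)) t /\ lterm_le t (repr (\pi_presented t)).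
Proof.
have /eqmodP/asboolP : repr (\pi_presented t) = t %[mod_eq lterm_equiv_rel].
  exact: reprK.
by [].
Qed.

Lemma pres_le_pi t u :
  pres_le (\pi_presented t) (\pi_presented u) = `[< lterm_le t u >].
Proof.
have [t1 t2] := lterm_reprK t; have [u1 u2] := lterm_reprK u.
apply/asboolP/asboolP => h.
  exact: lterm_le_trans t2 (lterm_le_trans h u1).
exact: lterm_le_trans t1 (lterm_le_trans h u2).
Qed.

Fact pres_display : Order.disp_t. Proof. exact: Order.Disp tt tt. Qed.

Fact pres_le_refl : reflexive pres_le.
Proof. by move=> p; apply/asboolP; apply: lterm_le_refl. Qed.

Fact pres_le_anti : antisymmetric pres_le.
Proof.
move=> p q /andP[/asboolP pq /asboolP qp].
rewrite -[p]reprK -[q]reprK; apply/eqmodP/asboolP; by split.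
Qed.

Fact pres_le_trans : transitive pres_le.
Proof.
move=> q p r /asboolP pq /asboolP qr; apply/asboolP.
exact: lterm_le_trans pq qr.
Qed.

HB.instance Definition _ := Order.Le_isPOrder.Build pres_display presented
  pres_le_refl pres_le_anti pres_le_trans.

Fact pres_lexI (p q r : presented) :
  (p <= pres_meet q r) = (p <= q) && (p <= r).
Proof.
rewrite -[p]reprK /Order.le /= !pres_le_pi -[q in RHS]reprK -[r in RHS]reprK.
rewrite !pres_le_pi; apply/asboolP/andP => [h|[/asboolP h1 /asboolP h2]].
  split; apply/asboolP; apply: lterm_le_trans h _.
    exact: lterm_leIl.
  exact: lterm_leIr.
exact: lterm_lexI.
Qed.

Fact pres_leUx (p q r : presented) :
  (pres_join p q <= r) = (p <= r) && (q <= r).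
Proof.
rewrite -[r]reprK /Order.le /= !pres_le_pi -[p in RHS]reprK -[q in RHS]reprK.
rewrite !pres_le_pi; apply/asboolP/andP => [h|[/asboolP h1 /asboolP h2]].
  split; apply/asboolP; apply: lterm_le_trans _ h.
    exact: lterm_leUl.
  exact: lterm_leUr.
exact: lterm_leUx.
Qed.

HB.instance Definition _ :=
  Order.POrder_MeetJoin_isLattice.Build pres_display presented
    pres_lexI pres_leUx.

Lemma pi_meet t u :
  \pi_presented (LMeet t u) = \pi_presented t `&` \pi_presented u.
Proof.
have [t1 t2] := lterm_reprK t; have [u1 u2] := lterm_reprK u.
apply/eqmodP/asboolP; split; apply: lterm_lexI.
- exact: lterm_le_trans (lterm_leIl _ _) t2.
- exact: lterm_le_trans (lterm_leIr _ _) u2.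
- exact: lterm_le_trans (lterm_leIl _ _) t1.
- exact: lterm_le_trans (lterm_leIr _ _) u1.
Qed.

Lemma pi_join t u :
  \pi_presented (LJoin t u) = \pi_presented t `|` \pi_presented u.
Proof.
have [t1 t2] := lterm_reprK t; have [u1 u2] := lterm_reprK u.
apply/eqmodP/asboolP; split; apply: lterm_leUx.
- exact: lterm_le_trans t2 (lterm_leUl _ _).
- exact: lterm_le_trans u2 (lterm_leUr _ _).
- exact: lterm_le_trans t1 (lterm_leUl _ _).
- exact: lterm_le_trans u1 (lterm_leUr _ _).
Qed.

Fact pres_meetUl : @left_distributive presented presented Order.meet Order.join.
Proof.
move=> p q r; apply: le_anti; apply/andP; split.
  have : \pi_presented (LMeet (LJoin (repr p) (repr q)) (repr r)) <=
         \pi_presented (LJoin (LMeet (repr p) (repr r)) (LMeet (repr q) (repr r))).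
    rewrite /Order.le /= pres_le_pi; apply/asboolP; exact: lterm_le_distr.
  by rewrite !(pi_meet, pi_join) !reprK.
by rewrite leUx !leI2 ?leUl ?leUr.
Qed.

HB.instance Definition _ :=
  Order.Lattice_Meet_isDistrLattice.Build pres_display presented pres_meetUl.

Fact pres_le0x (p : presented) : pres_bot <= p.
Proof.
rewrite -[p]reprK /Order.le /= pres_le_pi; apply/asboolP; exact: lterm_le0.
Qed.

Fact pres_lex1 (p : presented) : p <= pres_top.
Proof.
rewrite -[p]reprK /Order.le /= pres_le_pi; apply/asboolP; exact: lterm_le1.
Qed.

HB.instance Definition _ :=
  Order.hasBottom.Build pres_display presented pres_le0x.
HB.instance Definition _ := Order.hasTop.Build pres_display presented pres_lex1.

Lemma pi_bigmeet (A : seq S) :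
  \pi_presented (\big[LMeet/LTop]_(a <- A) LGen a) = \meet_(a <- A) pres_gen a.
Proof.
by elim: A => [|a A IH]; rewrite ?big_nil// !big_cons pi_meet IH.
Qed.

Lemma pi_bigjoin (B : seq S) :
  \pi_presented (\big[LJoin/LBot]_(b <- B) LGen b) = \join_(b <- B) pres_gen b.
Proof.
by elim: B => [|b B IH]; rewrite ?big_nil// !big_cons pi_join IH.
Qed.

Lemma pres_rel (A B : {fset S}) :
  R A B -> \meet_(a <- A) pres_gen a <= \join_(b <- B) pres_gen b.
Proof.
move=> RAB; rewrite -pi_bigmeet -pi_bigjoin /Order.le /= pres_le_pi.
by apply/asboolP; apply: lterm_le_rel.
Qed.

Lemma pres_universal d (M : tbDistrLatticeType d) (f : S -> M) :
  (forall A B, R A B -> \meet_(a <- A) f a <= \join_(b <- B) f b) ->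
  exists! h : presented -> M,
    [/\ forall s, h (pres_gen s) = f s, h \bot = \bot, h \top = \top,
        {morph h : p q / p `&` q} & {morph h : p q / p `|` q}].
Proof.
move=> fR.
pose fix ev (t : lterm) : M := match t with
  | LGen s => f s | LBot => \bot | LTop => \top
  | LMeet t u => ev t `&` ev u | LJoin t u => ev t `|` ev u end.
have evle t u : lterm_le t u -> ev t <= ev u.
  elim=> {t u} /=.
  - move=> A B /fR; set x := \meet_(_ <- _) _; set y := \join_(_ <- _) _.
    suff [-> ->] : ev (\big[LMeet/LTop]_(a <- A) LGen a) = x /\
                   ev (\big[LJoin/LBot]_(b <- B) LGen b) = y by [].
    by split; apply: big_morph.
  - by [].
  - by move=> t u v _ + _; apply: le_trans.
  - by move=> t; apply: le0x.
  - by move=> t; apply: lex1.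
  - by move=> t u; apply: leIl.
  - by move=> t u; apply: leIr.
  - by move=> t u v _ + _; rewrite lexI => -> ->.
  - by move=> t u; apply: leUl.
  - by move=> t u; apply: leUr.
  - by move=> t u v _ + _; rewrite leUx => -> ->.
  - by move=> t u v; rewrite meetUl.
have evpi t : ev (repr (\pi_presented t)) = ev t.
  by have [h1 h2] := lterm_reprK t; apply: le_anti; rewrite !evle.
exists (fun p => ev (repr p)); split.
  by split=> [s|||p q|p q]; rewrite evpi.
move=> h [hg h0 h1 hI hU]; apply: funext => p.
rewrite -[in RHS](reprK p); elim: (repr p) => /= [s|||t IHt u IHu|t IHt u IHu].
- by rewrite -hg.
- by rewrite -h0.
- by rewrite -h1.
- by rewrite pi_meet hI IHt IHu.
- by rewrite pi_join hU IHt IHu.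
Qed.

End Presentation.

(* The generator phi_i(a) is encoded as the pair (i, a). *)
Definition kr_gens (l : nat) d (L : tbDistrLatticeType d) : choiceType :=
  ('I_l.+1 * L)%type.

Definition phi (l : nat) d (L : tbDistrLatticeType d) (i : 'I_l.+1) (a : L) :
  kr_gens l L := (i, a).

Inductive kr_rel (l : nat) d (L : tbDistrLatticeType d) :
    {fset kr_gens l L} -> {fset kr_gens l L} -> Prop :=
| kr_rel1 i : kr_rel fset0 [fset phi i \top]
| kr_rel0 i : kr_rel [fset phi i \bot] fset0
| kr_relI i a b : kr_rel [fset phi i a; phi i b] [fset phi i (a `&` b)]
| kr_relU i a b : kr_rel [fset phi i (a `|` b)] [fset phi i a; phi i b]
| kr_rel_le i a b : a <= b -> kr_rel [fset phi i a] [fset phi i b]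
| kr_rel_step (i j : 'I_l.+1) a :
    j = i.+1 :> nat -> kr_rel [fset phi j a] [fset phi i a].

Definition Kr (l : nat) d (L : tbDistrLatticeType d) : Type :=
  presented (@kr_rel l d L).

HB.instance Definition _ l d (L : tbDistrLatticeType d) :=
  Order.TBDistrLattice.on (Kr l L).

Definition Kr_phi (l : nat) d (L : tbDistrLatticeType d) (i : 'I_l.+1) (a : L) :
  Kr l L := pres_gen (@kr_rel l d L) (phi i a).

Definition kr_entails (l : nat) d (L : tbDistrLatticeType d) :
    {fset kr_gens l L} -> {fset kr_gens l L} -> Prop :=
  generated_entailment (@kr_rel l d L).

(* Main.v *)
Require Import Defs.
From mathcomp Require Import all_boot all_order finmap.
Import Order.Theory.
Local Open Scope order_scope.

Set Implicit Arguments.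
Unset Strict Implicit.
Unset Printing Implicit Defensive.

(** Conditions (1) and (2) say the same thing for any presented lattice: the
    order of the lattice presented by [R] does not prove more sequents between
    generators than any entailment relation [E] containing [R]
    ([presented_le_entails]).  This is a completeness theorem, proved by a
    forcing model.  A world is a pair [(A, B)] of finite sets, read as the
    assumption that the generators in [A] are true and those in [B] false; it
    forces falsity when [E A B], that is, when this assumption is already
    contradictory.  Interpreting joins by double negation makes the model
    validate every lattice law, including distributivity, and the cut rule of
    [E] makes it validate [R].  Since the world [(A, B)] forces all of [A] and
    refutes all of [B], the inequality [/\A <= \/B] forces a contradiction
    there, which is [E A B].

    From (2) to (3), the sequents satisfying (3) are shown to form an
    entailment relation containing the defining relations of [Kr]
    ([chain_entails_entailment], [chain_entails_rel]).  It is convenient to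
    complete [x_1, ..., x_l] by [x_0 = \bot] and [x_(l+1) = \top], so that all
    lines of (3) have the same shape.  The cut rule, on a generator of level
    [k], glues two chains [x] and [y]: the join of both up to level [k] and the
    meet of both above it.

    From (3) to (1), each line of (3), read through [Kr_phi i], bounds
    [Kr_phi i (x_(i+1))] by [Kr_phi i (x_i)] modulo the two sides of (1), and
    [Kr_phi i (x_i) <= Kr_phi (i-1) (x_i)] lets the lines be chained from
    [Kr_phi 0 \bot = \bot] up to [Kr_phi l \top = \top] ([Kr_chain_le]). *)

(** * Conservativity of a presentation over entailment relations *)

Section Forcing.
Variables (S : choiceType) (R E : {fset S} -> {fset S} -> Prop).
Hypothesis (entE : is_entailment E) (RE : forall A B, R A B -> E A B).
Local Open Scope fset_scope.

Definition extends (A B A' B' : {fset S}) := A `<=` A' /\ B `<=` B'.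

(** The clause for joins is the double negation of a disjunction, where the
    negation of a term holds at a world if every extension forcing the term is
    contradictory. *)
Fixpoint forces (t : lterm S) (A B : {fset S}) : Prop :=
  match t with
  | LGen s => E A (s |` B)
  | LBot => E A B
  | LTop => True
  | LMeet t u => forces t A B /\ forces u A B
  | LJoin t u => forall A1 B1, extends A B A1 B1 ->
      (forall A2 B2, extends A1 B1 A2 B2 -> forces t A2 B2 -> E A2 B2) ->
      (forall A2 B2, extends A1 B1 A2 B2 -> forces u A2 B2 -> E A2 B2) ->
      E A1 B1
  end.

Lemma extends_refl A B : extends A B A B.
Proof. by split. Qed.

Lemma extends_trans A B A1 B1 A2 B2 :
  extends A B A1 B1 -> extends A1 B1 A2 B2 -> extends A B A2 B2.
Proof.
by move=> [a b] [a1 b1]; split; [apply: fsubset_trans a1 | apply: fsubset_trans b1].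
Qed.

Lemma entails_extends A B A1 B1 : extends A B A1 B1 -> E A B -> E A1 B1.
Proof. by case; apply: entail_mono. Qed.

Lemma entails_mem A B s : s \in A -> s \in B -> E A B.
Proof.
move=> sA sB; apply: (entail_mono entE _ _ (entail_refl entE s));
  by rewrite fsub1set.
Qed.

Lemma forces_extends t A B A1 B1 :
  extends A B A1 B1 -> forces t A B -> forces t A1 B1.
Proof.
elim: t A B A1 B1 => [s|||t IHt u IHu|t IHt u IHu] A B A1 B1 ext //=.
- by case: ext => AA BB; apply: entail_mono => //; apply: fsetUS.
- exact: entails_extends.
- by case=> ft fu; split; [apply: IHt ft | apply: IHu fu].
- by move=> f A2 B2 ext2; apply: f; apply: extends_trans ext2.
Qed.

(** Every term is equivalent to its double negation, so joins, although defined
    by negations, can be eliminated towards any term.  For a generator [s] the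
    reason is that assuming [s] false turns forcing [s] into a contradiction. *)
Lemma forces_stable t A B :
  (forall A1 B1, extends A B A1 B1 ->
    (forall A2 B2, extends A1 B1 A2 B2 -> forces t A2 B2 -> E A2 B2) ->
    E A1 B1) ->
  forces t A B.
Proof.
elim: t A B => [s|||t IHt u IHu|t IHt u IHu] A B //= dn.
- apply: dn; first by split=> //; apply: fsubsetUr.
  move=> A2 B2 [_ /fsubsetP sB2]; rewrite mem_fset1U //.
  by apply: sB2; rewrite !inE eqxx.
- by apply: (dn _ _ (extends_refl A B)).
- split; [apply: IHt | apply: IHu] => A1 B1 ext nf; apply: dn (ext) _.
    by move=> A2 B2 ext2 [ft _]; apply: nf.
  by move=> A2 B2 ext2 [_ fu]; apply: nf.
- move=> A1 B1 ext nt nu; apply: dn (ext) _ => A2 B2 ext2; apply.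
  + exact: extends_refl.
  + by move=> A3 B3 ext3; apply: nt; apply: extends_trans ext3.
  + by move=> A3 B3 ext3; apply: nu; apply: extends_trans ext3.
Qed.

Lemma forces_bigmeet (r : seq S) A B :
  forces (\big[@LMeet S/@LTop S]_(s <- r) LGen s) A B <->
  (forall s, s \in r -> E A (s |` B)).
Proof.
elim: r => [|a r IH]; rewrite ?big_nil ?big_cons //=; split.
  case=> fa /IH fr s; rewrite inE => /predU1P[-> //|]; exact: fr.
move=> f; split; first by apply: f; rewrite mem_head.
by apply/IH => s sr; apply: f; rewrite inE sr orbT.
Qed.

(** At a world refuting every member of [r], each [b] in [r] can be removed by
    a cut: adding [b] to the true generators forces [b], so that the refutation
    of [b] provides the premise of the cut in which [b] is on the left. *)
Lemma forces_bigjoin (r : seq S) A B :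
  E A ([fset s in r] `|` B) ->
  forces (\big[@LJoin S/@LBot S]_(s <- r) LGen s) A B.
Proof.
elim: r A B => [|b r IH] A B; rewrite ?big_nil ?big_cons /=.
  by apply: entail_mono => //; apply/fsubsetP => s; rewrite !inE.
move=> EAB A1 B1 ext nb nr.
apply: nr (extends_refl _ _) _; apply: IH.
apply: (entail_trans entE (x := b)).
  suff : E (b |` A1) B1.
    by apply: entail_mono => //; apply: fsubsetUr.
  apply: nb; first by split=> //; apply: fsubsetUr.
  by apply: (@entails_mem _ _ b); rewrite !inE eqxx.
have [AA BB] := ext; apply: entail_mono EAB => //.
apply/fsubsetP => s; rewrite !inE => /orP[/orP[->|->]|/(fsubsetP BB) ->] //;
  by rewrite !orbT.
Qed.

Lemma forces_bigjoin_mem (r : seq S) A B : {subset r <= B} ->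
  forces (\big[@LJoin S/@LBot S]_(s <- r) LGen s) A B -> E A B.
Proof.
elim: r A B => [|b r IH] A B; rewrite ?big_nil ?big_cons //= => rB.
apply; first exact: extends_refl.
  move=> A2 B2 [_ /fsubsetP BB]; rewrite mem_fset1U //.
  by apply/BB/rB; rewrite mem_head.
move=> A2 B2 [_ /fsubsetP BB]; apply: IH => s sr.
by apply/BB/rB; rewrite inE sr orbT.
Qed.

Lemma entails_cut_fset (r : seq S) A B :
  (forall s, s \in r -> E A (s |` B)) -> E ([fset s in r] `|` A) B -> E A B.
Proof.
elim: r => [|a r IH] rA.
  by apply: entail_mono => //; apply/fsubsetP => s; rewrite !inE.
move=> EAB; apply: IH => [s sr|]; first by apply: rA; rewrite inE sr orbT.
apply: (entail_trans entE (x := a)).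
  apply: entail_mono EAB => //; apply/fsubsetP => s.
  by rewrite !inE orbA.
have := rA a (mem_head _ _).
by apply: entail_mono => //; apply: fsubsetUr.
Qed.

(** The given relations hold by cuts in [E], and the elimination of joins and
    of falsity by stability.  Distributivity comes from persistence: what is
    forced at a world is still available in the extensions where a disjunct
    is examined. *)
Lemma forces_sound t u :
  lterm_le R t u -> forall A B, forces t A B -> forces u A B.
Proof.
elim=> {t u} /=.
- move=> C D RCD A B /forces_bigmeet fC; apply: forces_bigjoin.
  apply: (@entails_cut_fset C).
    move=> s /fC; apply: (entail_mono entE) => //.
    by apply: fsetUS; apply: fsubsetUr.
  apply: (entail_mono entE) (RE RCD); apply/fsubsetP => s; rewrite !inE => -> //.
- by [].
- by move=> t u v _ IH1 _ IH2 A B /IH1/IH2.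
- move=> t A B EAB; apply: forces_stable => A1 B1 ext _.
  exact: entails_extends EAB.
- by [].
- by move=> t u A B [].
- by move=> t u A B [].
- by move=> t u v _ IH1 _ IH2 A B ft; split; [apply: IH1 | apply: IH2].
- move=> t u A B ft A1 B1 ext nt _; apply: nt (extends_refl _ _) _.
  exact: forces_extends ft.
- move=> t u A B fu A1 B1 ext _ nu; apply: nu (extends_refl _ _) _.
  exact: forces_extends fu.
- move=> t u v _ IH1 _ IH2 A B ftu; apply: forces_stable => A1 B1 ext nv.
  by apply: ftu (ext) _ _ => A2 B2 ext2 f; apply: nv ext2 _;
    [apply: IH1 | apply: IH2].
- move=> t u v A B [ftu fv] A1 B1 ext nt nu.
  apply: ftu (ext) _ _ => A2 B2 ext2 f.
    apply: nt (ext2) _; split=> //; apply: forces_extends fv.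
    exact: extends_trans ext ext2.
  apply: nu (ext2) _; split=> //; apply: forces_extends fv.
  exact: extends_trans ext ext2.
Qed.

(** The world [(A, B)] itself forces every member of [A], hence the join of
    [B], all of whose members it refutes. *)
Lemma presented_le_entails (A B : {fset S}) :
  \meet_(a <- A) pres_gen R a <= \join_(b <- B) pres_gen R b -> E A B.
Proof.
rewrite -pi_bigmeet -pi_bigjoin /Order.le /= pres_le_pi => /boolp.asboolP h.
apply: (@forces_bigjoin_mem B) => //.
apply: (forces_sound h); apply/forces_bigmeet => s sA.
by apply: (@entails_mem _ _ s) => //; rewrite !inE eqxx.
Qed.

End Forcing.

(** * The entailment relation of interpolating chains *)

Section KrChain.
Variables (l : nat) (d : Order.disp_t) (L : tbDistrLatticeType d).
Implicit Types (A B : {fset kr_gens l L}) (z : nat -> L).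

Definition layer_meet A (i : nat) : L := \meet_(p <- A | p.1 == i :> nat) p.2.
Definition layer_join B (i : nat) : L := \join_(p <- B | p.1 == i :> nat) p.2.

(** The indices outside [1 .. l] are pinned to the bounds of [L], which erases
    the missing [x_(l+1)] on the last line and the missing [x_0] on the first
    one. *)
Definition chain_entails A B : Prop :=
  exists2 z : nat -> L, z 0 = \bot /\ z l.+1 = \top &
    forall i, (i <= l)%N ->
      z i.+1 `&` layer_meet A i <= layer_join B i `|` z i.

Lemma layer_meet_le A (i : 'I_l.+1) a : phi i a \in A -> layer_meet A i <= a.
Proof. by move=> iaA; apply: (@meets_inf_seq _ _ _ _ _ snd (i, a)) => //=. Qed.

Lemma le_layer_join B (i : 'I_l.+1) b : phi i b \in B -> b <= layer_join B i.
Proof. by move=> ibB; apply: (@joins_sup_seq _ _ _ _ _ snd (i, b)) => //=. Qed.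

Lemma layer_meetS A A' i : (A `<=` A')%fset -> layer_meet A' i <= layer_meet A i.
Proof.
move=> /fsubsetP AA; apply/meetsP_seq => p pA pi.
by apply: (@meets_inf_seq _ _ _ _ _ snd p) => //; apply: AA.
Qed.

Lemma layer_joinS B B' i : (B `<=` B')%fset -> layer_join B i <= layer_join B' i.
Proof.
move=> /fsubsetP BB; apply/joinsP_seq => p pB pi.
by apply: (@joins_sup_seq _ _ _ _ _ snd p) => //; apply: BB.
Qed.

Lemma layer_meetU1 (k : 'I_l.+1) a A i :
  (if k == i :> nat then a else \top) `&` layer_meet A i
    <= layer_meet ((k, a) |` A)%fset i.
Proof.
apply/meetsP_seq => p; rewrite !inE => /predU1P[-> /= ->|pA pi].
  exact: leIl.
by apply: leIxr; apply: (@meets_inf_seq _ _ _ _ _ snd p).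
Qed.

Lemma layer_joinU1 (k : 'I_l.+1) b B i :
  layer_join ((k, b) |` B)%fset i
    <= (if k == i :> nat then b else \bot) `|` layer_join B i.
Proof.
apply/joinsP_seq => p; rewrite !inE => /predU1P[-> /= ->|pB pi].
  exact: leUl.
by apply: lexUr; apply: (@joins_sup_seq _ _ _ _ _ snd p).
Qed.

(** A sequent that already holds within one level [k] is interpolated by the
    threshold chain that jumps from [\bot] to [\top] between [k] and [k.+1]:
    every other line is then trivial. *)
Lemma chain_entails_layer A B (k : 'I_l.+1) :
  layer_meet A k <= layer_join B k -> chain_entails A B.
Proof.
move=> AB; exists (fun i => if (i <= k)%N then \bot else \top).
  by rewrite leq0n leqNgt ltn_ord.
move=> i _; have [ik|ki|->] := ltngtP i k.
- by rewrite meet0x le0x.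
- by rewrite joinx1 lex1.
- by rewrite joinx0 meet1x.
Qed.

Lemma chain_entails_refl p : chain_entails [fset p]%fset [fset p]%fset.
Proof.
case: p => k a; apply: (@chain_entails_layer _ _ k).
by apply: le_trans (layer_meet_le (a := a) _) (le_layer_join _); rewrite inE.
Qed.

Lemma chain_entails_mono A A' B B' :
  (A `<=` A')%fset -> (B `<=` B')%fset ->
  chain_entails A B -> chain_entails A' B'.
Proof.
move=> AA BB [z z01 zAB]; exists z => // i il.
apply: le_trans (le_trans (zAB i il) _).
  exact: leI2 (lexx _) (layer_meetS _ AA).
exact: leU2 (layer_joinS _ BB) (lexx _).
Qed.

Lemma distr_cut (a b p x y : L) :
  x `&` (a `&` p) <= b -> y `&` p <= a `|` b -> (x `&` y) `&` p <= b.
Proof.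
move=> h1 h2.
have h3 : (x `&` y) `&` p <= x `&` p `&` (a `|` b).
  by rewrite lexI leI2 ?leIl // (le_trans _ h2) // leI2 // leIr.
apply: le_trans h3 _; rewrite meetUr leUx leIr andbT.
by apply: le_trans h1; rewrite -meetA [p `&` a]meetC.
Qed.

(** Below the level [k] of the cut generator the lines of both chains have no
    extra formula and are joined, above it they are met; at level [k] the
    glued chain has the join on the right and the meet on the left, which is
    exactly what the cut rule of [L] delivers. *)
Lemma chain_entails_cut A B p :
  chain_entails (p |` A)%fset B -> chain_entails A (p |` B)%fset ->
  chain_entails A B.
Proof.
case: p => k a [x [x0 x1] xAB] [y [y0 y1] yAB].
exists (fun i => if (i <= k)%N then x i `|` y i else x i `&` y i).
  by rewrite leq0n leqNgt ltn_ord /= x0 y0 x1 y1 joinxx meetxx.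
move=> i il.
have := le_trans (leI2 (lexx _) (layer_meetU1 k a A i)) (xAB i il).
have := le_trans (yAB i il) (leU2 (layer_joinU1 k a B i) (lexx _)).
move: (layer_meet A i) (layer_join B i) => m j.
have [ik|ki|ik] := ltngtP i k; last first.
- rewrite -joinA => hy hx; apply: distr_cut.
    by apply: le_trans hx _; rewrite leU2 // leUl.
  by apply: le_trans hy _; rewrite leU2 // leU2 // leUr.
- rewrite join0x meet1x => hy hx; rewrite joinIr lexI.
  by rewrite (le_trans _ hx) ?(le_trans _ hy) // leI2 ?leIl ?leIr.
- rewrite join0x meet1x => hy hx; rewrite meetUl leUx.
  by rewrite (le_trans hx) ?(le_trans hy) // leU2 ?leUl ?leUr.
Qed.

Lemma chain_entails_entailment : is_entailment chain_entails.
Proof.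
split; [exact: chain_entails_refl | exact: chain_entails_mono |].
by move=> A B p; apply: chain_entails_cut.
Qed.

Lemma chain_entails_rel A B : kr_rel A B -> chain_entails A B.
Proof.
case=> {A B} [i|i|i a b|i a b|i a b ab|i j a ji].
- apply: (@chain_entails_layer _ _ i).
  by apply: le_trans (lex1 _) (le_layer_join _); rewrite inE.
- apply: (@chain_entails_layer _ _ i).
  by apply: le_trans (layer_meet_le (a := \bot) _) (le0x _); rewrite inE.
- apply: (@chain_entails_layer _ _ i).
  apply: le_trans (le_layer_join (b := a `&` b) _); last by rewrite inE.
  by rewrite lexI !layer_meet_le // !inE eqxx ?orbT.
- apply: (@chain_entails_layer _ _ i).
  apply: le_trans (layer_meet_le (a := a `|` b) _) _; first by rewrite inE.
  by rewrite leUx !le_layer_join // !inE eqxx ?orbT.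
- apply: (@chain_entails_layer _ _ i).
  by apply: le_trans (layer_meet_le (a := a) _) (le_trans ab (le_layer_join _));
    rewrite inE.
(* The threshold chain with the value a inserted at the level i + 1 of the
   jump, which carries a from the upper level to the lower one. *)
- exists (fun n => if (n <= i)%N then \bot else if n == j :> nat then a else \top).
    by rewrite leq0n leqNgt ltn_ord /= gtn_eqF.
  move=> n nl; have [ni|jn|->] := ltngtP n i.
  + by rewrite meet0x le0x.
  + have [->|_] := eqVneq n j; last by rewrite joinx1 lex1.
    rewrite gtn_eqF // meet1x lexUr // layer_meet_le // inE //.
  + by rewrite ji eqxx joinx0 leIxl // le_layer_join // inE.
Qed.

Lemma kr_entails_chain A B : kr_entails A B -> chain_entails A B.
Proof. by apply; [exact: chain_entails_entailment | exact: chain_entails_rel]. Qed.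

(** * Chains give inequalities in the presented lattice *)

Lemma Kr_phiT i : Kr_phi i (\top : L) = \top :> Kr l L.
Proof.
apply: le_anti; rewrite lex1 /=.
by have := pres_rel (kr_rel1 L i); rewrite big_seq_fset0 big_seq_fset1.
Qed.

Lemma Kr_phi0 i : Kr_phi i (\bot : L) = \bot :> Kr l L.
Proof.
apply: le_anti; rewrite le0x andbT.
by have := pres_rel (kr_rel0 L i); rewrite big_seq_fset0 big_seq_fset1.
Qed.

Lemma Kr_phi_le (i : 'I_l.+1) (a b : L) : a <= b -> Kr_phi i a <= Kr_phi i b.
Proof.
by move=> ab; have := pres_rel (kr_rel_le i ab); rewrite !big_seq_fset1.
Qed.

Lemma Kr_phi_step (i j : 'I_l.+1) (a : L) :
  j = i.+1 :> nat -> Kr_phi j a <= Kr_phi i a.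
Proof.
by move=> ij; have := pres_rel (kr_rel_step a ij); rewrite !big_seq_fset1.
Qed.

Lemma Kr_phiI (i : 'I_l.+1) (a b : L) :
  Kr_phi i a `&` Kr_phi i b <= Kr_phi i (a `&` b).
Proof.
have := pres_rel (kr_relI i a b); rewrite big_seq_fset1; apply: le_trans.
apply/meetsP_seq => p; rewrite !inE => /orP[/eqP->|/eqP->] _.
  exact: leIl.
exact: leIr.
Qed.

Lemma Kr_phiU (i : 'I_l.+1) (a b : L) :
  Kr_phi i (a `|` b) <= Kr_phi i a `|` Kr_phi i b.
Proof.
have := pres_rel (kr_relU i a b); rewrite big_seq_fset1 => /le_trans; apply.
apply/joinsP_seq => p; rewrite !inE => /orP[/eqP->|/eqP->] _.
  exact: leUl.
exact: leUr.
Qed.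

Lemma Kr_phi_meets (i : 'I_l.+1) (r : seq L) :
  \meet_(a <- r) Kr_phi i a <= Kr_phi i (\meet_(a <- r) a).
Proof.
elim: r => [|a r IH]; rewrite ?big_nil ?Kr_phiT // !big_cons.
by apply: le_trans (Kr_phiI _ _ _); apply: leI2.
Qed.

Lemma Kr_phi_joins (i : 'I_l.+1) (r : seq L) :
  Kr_phi i (\join_(a <- r) a) <= \join_(a <- r) Kr_phi i a.
Proof.
elim: r => [|a r IH]; rewrite ?big_nil ?Kr_phi0 // !big_cons.
by apply: le_trans (Kr_phiU _ _ _) _; apply: leU2.
Qed.

(** By induction on [i], the left-hand side meets [Kr_phi i (z i.+1)] below the
    right-hand side; at [i = l] the factor [Kr_phi l \top] disappears. *)
Lemma Kr_chain_le (U J : 'I_l.+1 -> {fset L}) z :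
  z 0 = \bot -> z l.+1 = \top ->
  (forall i : 'I_l.+1,
     z i.+1 `&` \meet_(u <- U i) u <= \join_(j <- J i) j `|` z i) ->
  \meet_(i < l.+1) \meet_(u <- U i) Kr_phi i u
    <= \join_(i < l.+1) \join_(j <- J i) Kr_phi i j.
Proof.
move=> z0 z1 zUJ; set M := \meet_(i < _) _; set N := \join_(i < _) _.
have step (i : 'I_l.+1) : M `&` Kr_phi i (z i.+1) <= N `|` Kr_phi i (z i).
  apply: (@le_trans _ _ (Kr_phi i (z i.+1 `&` \meet_(u <- U i) u))).
    apply: le_trans (Kr_phiI _ _ _); rewrite meetC leI2 //.
    by apply: le_trans (Kr_phi_meets _ _); apply: meets_inf.
  apply: le_trans (Kr_phi_le _ (zUJ i)) _; apply: le_trans (Kr_phiU _ _ _) _.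
  rewrite leU2 //; apply: le_trans (Kr_phi_joins _ _) _.
  by apply: (@joins_sup _ _ _ i xpredT (fun i => \join_(j <- J i) Kr_phi i j)).
have all_le (i : nat) (il : (i < l.+1)%N) : M `&` Kr_phi (Ordinal il) (z i.+1) <= N.
  elim: i il => [|i IH] il; have := step (Ordinal il) => /=.
    by rewrite z0 Kr_phi0 joinx0.
  move=> h; have h1 : Kr_phi (Ordinal il) (z i.+1) <=
                      Kr_phi (Ordinal (ltnW il)) (z i.+1).
    exact: Kr_phi_step.
  rewrite -[M]meetxx -meetA; apply: le_trans (leI2 (lexx _) h) _.
  by rewrite meetUr leUx leIr /= (le_trans _ (IH (ltnW il))) // leI2.
by have := all_le l (ltnSn l); rewrite z1 Kr_phiT meetx1.
Qed.

End KrChain.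

(** * The lines of the chain as sequents of the base lattice *)

Section Lines.
Variables (l : nat) (d : Order.disp_t) (L : tbDistrLatticeType d).
Local Open Scope fset_scope.

(** The sets [[fset x k | ...]] have at most one element; an empty one
    contributes [\top] on the left or [\bot] on the right, which is the value
    of [z] at the corresponding end. *)
Lemma lat_entails_line (x : 'I_l -> L) (z : nat -> L) (U J : {fset L})
    (i : 'I_l.+1) :
  z 0 = \bot -> z l.+1 = \top -> (forall k : 'I_l, x k = z k.+1) ->
  lat_entails ([fset x k | k : 'I_l & (k : nat) == i] `|` U)
              (J `|` [fset x k | k : 'I_l & k.+1 == i])
  = (z i.+1 `&` \meet_(u <- U) u <= \join_(j <- J) j `|` z i)%O.
Proof.
move=> z0 z1 xz; rewrite /lat_entails; congr (_ <= _)%O; apply: le_anti.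
- rewrite lexI -andbA; apply/and3P; split.
  + have [il|li] := ltnP i l.
      rewrite -(xz (Ordinal il)); apply: (@meets_inf_seq _ _ _ _ _ id) => //.
      by rewrite inE in_imfset //= inE.
    by rewrite (_ : i = l :> nat) ?z1 ?lex1 //; apply/eqP;
      rewrite eqn_leq li -ltnS ltn_ord.
  + apply/meetsP_seq => u uU _; apply: (@meets_inf_seq _ _ _ _ _ id) => //.
    by rewrite inE uU orbT.
  + apply/meetsP_seq => u; rewrite inE => /orP[/imfsetP[k /= ki ->]|uU] _.
      by rewrite xz; move: ki; rewrite inE => /eqP ->; apply: leIl.
    by apply: leIxr; apply: (@meets_inf_seq _ _ _ _ _ id).
- apply/andP; split.
  + apply/joinsP_seq => u; rewrite inE => /orP[uJ|/imfsetP[k /= ki ->]] _.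
      by apply: lexUl; apply: (@joins_sup_seq _ _ _ _ _ id).
    by rewrite xz; move: ki; rewrite inE => /eqP ->; apply: leUr.
  + rewrite leUx; apply/andP; split.
      apply/joinsP_seq => u uJ _; apply: (@joins_sup_seq _ _ _ _ _ id) => //.
      by rewrite inE uJ.
    case: i => [[|i] il] /=; first by rewrite z0 le0x.
    rewrite -(xz (Ordinal (il : (i < l)%N))).
    apply: (@joins_sup_seq _ _ _ _ _ id) => //.
    by rewrite inE in_imfset ?orbT //= inE.
Qed.

(** The completion of [x_1, ..., x_l] by [\bot] at [0] and [\top] beyond [l]. *)
Definition chain_of (x : 'I_l -> L) (n : nat) : L :=
  if n is k.+1 then oapp x \top (insub k) else \bot.

End Lines.

Lemma mem_layers (l : nat) d (L : tbDistrLatticeType d)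
    (U : 'I_l.+1 -> {fset L}) (i : 'I_l.+1) (a : L) :
  ((i, a) \in \big[fsetU/fset0]_(i < l.+1) [fset phi i u | u in U i])%fset
  = (a \in U i).
Proof.
apply/bigfcupP/idP => [[k _ /imfsetP[u /= uU [-> ->]]] //|aU].
by exists i; rewrite ?mem_index_enum // in_imfset.
Qed.

Theorem theorem2p3 (d : Order.disp_t) (L : tbDistrLatticeType d) (l : nat)
    (U J : 'I_l.+1 -> {fset L}) :
  [<-> \meet_(i < l.+1) \meet_(u <- U i) Kr_phi i u
         <= \join_(i < l.+1) \join_(j <- J i) Kr_phi i j;
       kr_entails (\big[fsetU/fset0]_(i < l.+1) [fset phi i u | u in U i])%fset
                  (\big[fsetU/fset0]_(i < l.+1) [fset phi i j | j in J i])%fset;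
       exists x : 'I_l -> L, forall i : 'I_l.+1,
         lat_entails
           ([fset x k | k : 'I_l & (k : nat) == i] `|` U i)%fset
           (J i `|` [fset x k | k : 'I_l & k.+1 == i])%fset].
Proof.
tfae.
- move=> UJ E entE RE; apply: (presented_le_entails entE RE).
  apply: le_trans (le_trans UJ _).
    apply/meetsP => i _; apply/meetsP_seq => u uU _.
    apply: (@meets_inf_seq _ _ _ _ _ (@pres_gen _ _) (phi i u)) => //.
    by rewrite mem_layers.
  apply/joinsP => i _; apply/joinsP_seq => j jJ _.
  apply: (@joins_sup_seq _ _ _ _ _ (@pres_gen _ _) (phi i j)) => //.
  by rewrite mem_layers.
- move=> /kr_entails_chain [z [z0 z1] zUJ].
  exists (fun k => z k.+1) => i; rewrite (lat_entails_line _ _ _ z0 z1) //.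
  apply: le_trans (le_trans (zUJ i _) _); last 2 first.
  + by rewrite -ltnS.
  + apply: leU2 => //; apply/joinsP_seq => -[k j] kjJ /= /eqP/val_inj ki.
    by apply: (@joins_sup_seq _ _ _ _ _ id) => //; rewrite -mem_layers -ki.
  + apply: leI2 => //; apply/meetsP_seq => -[k u] kuU /= /eqP/val_inj ki.
    by apply: (@meets_inf_seq _ _ _ _ _ id) => //; rewrite -mem_layers -ki.
- move=> [x xUJ]; apply: (@Kr_chain_le _ _ _ _ _ (chain_of x)) => //.
    by rewrite /= insubN // ltnn.
  move=> i; rewrite -(@lat_entails_line _ _ _ x) //=.
    by rewrite insubN // ltnn.
  by move=> k; rewrite valK.
Qed.
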